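(* Let $m\in\{4,5\}$. Any nontrivial upcycle for $A^n$ with frame period $m$ has diamondicity $\frac{n}{m}$. Every nontrivial upcycle for $A^m$ has diamondicity $1$.
   Context: Let $A$ be an alphabet with $|A|\ge 2$ letters and $\diamond\notin A$ a wildcard symbol (''diamond''). A partial word is a finite sequence over $A\cup\{\diamond\}$; a cyclic partial word $u=(u_1\cdots u_N)$ is cyclically ordered, with indices taken modulo $N$. A partial word $x$ covers a word $y$ of the same length if for each $i$ either $x_i=\diamond$ or $x_i=y_i$. For $n\ge 1$, an upcycle for $A^n$ is a cyclic partial word $u=(u_1\cdots u_N)$ such that for each word $y\in A^n$ there is exactly one position $i\in\{1,\dots,N\}$ such that the window $u_i\cdots u_{i+n-1}$ covers $y$. It is known that the diamonds of an upcycle are $n$-periodic ($u_i=\diamond$ implies $u_{i+n}=\diamond$), so all windows contain the same number $d$ of diamonds, called the diamondicity. An upcycle is nontrivial if it contains at least one diamond and at least one letter. The frame of a (cyclic) partial word is obtained by replacing each letter by $\bullet$ and keeping each $\diamond$. The pane frame of a window with frame $f\in\{\bullet,\diamond\}^n$ is the shortest word $p$ such that $p^s=f$ for some positive integer $s$. The frame period of an upcycle for $A^n$ is the length of the pane frame of a window (independent of the window, since the window frames are cyclic shifts of each other); equivalently it is the minimum period of the frame of the upcycle. *)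

(* Defs.v *)
From mathcomp Require Import all_boot.

Set Implicit Arguments.
Unset Strict Implicit.
Unset Printing Implicit Defensive.

(* Partial words over A are sequences over option A: None is the wildcard
   diamond, Some a is the letter a. *)
Definition pword (A : Type) := seq (option A).

Definition covers (A : eqType) (x : pword A) (y : seq A) : bool :=
  all2 (fun (c : option A) (a : A) => (c == None) || (c == Some a)) x y.

(* A cyclic partial word is given by a sequence u, read cyclically from its
   first entry; the default value None of nth is reached only if u is empty,
   and n may exceed size u. Positions are numbered from 0. *)
Definition window (A : Type) (n : nat) (u : pword A) (i : nat) : pword A :=
  [seq nth None u ((i + k) %% size u) | k <- iota 0 n].

Definition upcycle (A : finType) (n : nat) (u : pword A) : Prop :=
  0 < n /\
  forall y : n.-tuple A, exists! i : 'I_(size u), covers (window n u i) y.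

Definition nontrivial (A : finType) (u : pword A) : Prop :=
  None \in u /\ exists a : A, Some a \in u.

Definition has_diamondicity (A : finType) (n : nat) (u : pword A) (d : nat)
    : Prop :=
  forall i : 'I_(size u), count_mem None (window n u i) = d.

(* In a frame, true stands for a bullet (letter) and false for a diamond. *)
Definition frame (A : Type) (x : pword A) : seq bool := [seq isSome c | c <- x].

Definition is_root (p f : seq bool) : Prop :=
  exists s : nat, 0 < s /\ flatten (nseq s p) = f.

Definition pane_frame (p f : seq bool) : Prop :=
  is_root p f /\ forall q : seq bool, is_root q f -> size p <= size q.

Definition has_frame_period (A : finType) (n : nat) (u : pword A) (m : nat)
    : Prop :=
  forall i : 'I_(size u),
    exists p : seq bool, pane_frame p (frame (window n u i)) /\ size p = m.

(* Main.v *)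
Require Import Defs.
From mathcomp Require Import all_boot.
From mathcomp Require Import zify.

Set Implicit Arguments.
Unset Strict Implicit.
Unset Printing Implicit Defensive.

(** If [u_i] is a diamond then so is [u_(i+n)], so the frame of the upcycle has
    period [m]. Two windows at different positions cannot have disjoint sets of
    letter positions, since some word would then be covered by both; hence the
    set [S] of letter residues satisfies [S - S = Z/m]. This leaves one diamond
    per period, or [m = 5] and two diamonds per period.

    In the latter case some difference [d] is realised exactly once in [S], by
    residues [r0] and [r0 + d]. Write [n = 5s] and let [V(i)] be the word
    [u_i u_(i+5) ... u_(i+5(s-1))]. Windows at distance [d] share letters in
    just one residue class, so words [V(i)] with [i = r0] and words [V(j)] with
    [j = r0 + d] modulo 5 are always different. Let [N] be the length of [u],
    [D] its number of diamonds, [C(x)] the number of [i] with [V(i) = x] and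
    [a = |A|^s]. Counting the words of length [n] whose entries in one residue
    class form [x] gives [a^4 = a^2 C(x) + a D]. Choose [x] among the [V(r0 + d)]
    and [y] among the [V(r0)]: the count of the words whose entries in the
    classes [0] and [d] form [x] and [y] gives [a^3 = a (C(x) + C(y))]. Together
    with [a^5 = N a^2] this yields [N = 2 D], while [5 D = 2 N]. *)

(** * Sums of periodic functions *)

Lemma modn_periodic (T : Type) (P : nat -> T) m :
  (forall k, P (k + m) = P k) -> forall k, P (k %% m) = P k.
Proof.
move=> PP k; rewrite [in RHS](divn_eq k m) addnC.
by elim: (k %/ m) => [|q IH]; rewrite ?addn0 // mulSn addnCA [m + _]addnC PP.
Qed.

Lemma sum_periodic (P : nat -> nat) m : (forall k, P (k + m) = P k) ->
  forall t, \sum_(i < m) P (t + i) = \sum_(i < m) P i.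
Proof.
move=> PP; elim=> [//|t IH]; rewrite -{}IH.
case: m PP => [|m] PP; first by rewrite !big_ord0.
rewrite big_ord_recr [RHS]big_ord_recl /= addnC addn0 addSnnS PP.
by congr (_ + _); apply: eq_bigr => i _; rewrite /bump /= addSnnS.
Qed.

Lemma sum_periodic_mul (P : nat -> nat) m s : (forall k, P (k + m) = P k) ->
  \sum_(i < m * s) P i = s * \sum_(i < m) P i.
Proof.
move=> PP; elim: s => [|s IH]; first by rewrite muln0 big_ord0.
rewrite mulnS addnC big_split_ord /= IH mulSn addnC; congr (_ + _).
exact: sum_periodic.
Qed.

Lemma count_iota (P : pred nat) m : count P (iota 0 m) = \sum_(k < m) P k.
Proof.
by rewrite -(big_mkord xpredT (fun k => P k : nat)) /index_iota subn0 -sum1_count big_mkcond.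
Qed.

Lemma sum_ord5 (P : nat -> nat) :
  \sum_(i < 5) P i = P 0 + P 1 + P 2 + P 3 + P 4.
Proof. by rewrite !big_ord_recr big_ord0. Qed.

(** * Counting the total words covered by partial words *)

Section PartialFunctions.

Variables (A : finType) (n : nat).
Implicit Types (c d : nat -> option A) (w : {ffun 'I_n -> A}).

(** Partial words are functions on [nat] read below [n], so that all windows become shifts of one
    periodic sequence. *)
Definition extends c w := [forall k : 'I_n, (c k == None) || (c k == Some (w k))].

Definition compatible c d :=
  [forall k : 'I_n, [|| c k == None, d k == None | c k == d k]].

Lemma card_extends c :
  #|[pred w | extends c w]| = #|A| ^ (\sum_(k < n) (c k == None)).
Proof.
pose R (k : 'I_n) := [pred a | (c k == None) || (c k == Some a)].
have /eq_card -> : [pred w | extends c w] =i family R.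
  by move=> w; rewrite !inE; apply: eq_forallb.
rewrite card_family foldrE big_image /= expn_sum.
apply: eq_bigr => k _; rewrite /R; case: (c k) => [b|] /=.
  by rewrite expn0 -(card1 b); apply: eq_card => a; rewrite !inE eq_sym.
by rewrite expn1; apply: eq_card => a.
Qed.

(** Two compatible partial words merge into one, which takes the letter of [d] wherever [c] has a
    diamond; counting common extensions thus reduces to [card_extends]. *)
Lemma extends2 c d w : extends c w && extends d w =
  compatible c d && extends (fun k => if c k is Some a then Some a else d k) w.
Proof.
apply/andP/andP => -[/forallP cw /forallP dw]; split; apply/forallP => k;
  move: (cw k) (dw k); case: (c k) (d k) => [a|] [b|] //=.
- by do 2 move/eqP->.
- by move=> /eqP[->] /eqP[->].
Qed.

Lemma card_extends2 c d :
  #|[pred w | extends c w && extends d w]| =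
  compatible c d * #|A| ^ (\sum_(k < n) ((c k == None) && (d k == None))).
Proof.
rewrite (eq_card (B := [pred w | compatible c d && extends
  (fun k => if c k is Some a then Some a else d k) w])); last first.
  by move=> w; rewrite !inE extends2.
case: (compatible c d); last by rewrite mul0n; apply: eq_card0.
rewrite mul1n (card_extends (fun k => if c k is Some a then Some a else d k)).
by congr (_ ^ _); apply: eq_bigr => k _; case: (c k).
Qed.

Lemma compatible_extends (a0 : A) c d : compatible c d ->
  exists w, extends c w && extends d w.
Proof.
move=> cd.
exists [ffun k : 'I_n => odflt a0 (if c k is Some a then Some a else d k)].
rewrite extends2 cd; apply/forallP => k; rewrite ffunE.
by case: (c k) (d k) => [a|] [b|] //=.
Qed.

End PartialFunctions.

(** * Double counting over windows, and periodicity of the diamonds *)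

Section Upcycle.

Variables (A : finType) (n : nat) (u : pword A).
Hypothesis cardA : 1 < #|A|.
Hypothesis upu : upcycle n u.
Hypothesis ntu : nontrivial u.

Let N := size u.
Let g k := nth None u (k %% N).
Let F k := isSome (g k).
Let win i k := g (i + k).

Lemma size_upcycle_gt0 : 0 < N.
Proof. by case: ntu; rewrite /N; case: (u). Qed.

Lemma letter_exists : A.
Proof. by case: (pickP A) => [//|/eq_card0 A0]; have := cardA; rewrite A0. Qed.

Lemma gDN k : g (k + N) = g k.
Proof. by rewrite /g modnDr. Qed.

Lemma g_eqmod i j k : i = j %[mod N] -> g (i + k) = g (j + k).
Proof. by move=> ij; rewrite /g -modnDml ij modnDml. Qed.

Lemma windowE i : window n u i = [seq win i k | k <- iota 0 n].
Proof. by []. Qed.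

Lemma covers_extends i (w : {ffun 'I_n -> A}) :
  covers (window n u i) [tuple w k | k < n] = extends (win i) w.
Proof.
rewrite windowE /covers -val_enum_ord /= -map_comp.
have -> (e : seq 'I_n) (p : option A -> A -> bool) :
    all2 p (map (win i \o val) e) (map w e) = all (fun k => p (win i (val k)) (w k)) e.
  by elim: e => //= k e ->.
apply/allP/forallP => [H k|H k _]; last exact: H.
by apply: H; rewrite mem_enum.
Qed.

Lemma extends_uniq (w : {ffun 'I_n -> A}) i j :
  extends (win i) w -> extends (win j) w -> i = j %[mod N].
Proof.
move=> iw jw; have N0 := size_upcycle_gt0.
have [_ /(_ [tuple w k | k < n]) [l [_ lP]]] := upu.
have red k : extends (win k) w -> k %% N = l.
  move=> kw; suff -> : l = Ordinal (ltn_pmod k N0) by [].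
  apply: lP; rewrite covers_extends /=.
  apply/forallP => t; move/forallP/(_ t): kw.
  by rewrite /win (@g_eqmod (k %% N) k) ?modn_mod.
by rewrite (red i) // (red j).
Qed.

Lemma extends_ex (w : {ffun 'I_n -> A}) : exists i : 'I_N, extends (win i) w.
Proof.
have [_ /(_ [tuple w k | k < n]) [l [+ _]]] := upu.
by rewrite covers_extends; exists l.
Qed.

Lemma sum_extends (w : {ffun 'I_n -> A}) : \sum_(i < N) extends (win i) w = 1.
Proof.
have [i iw] := extends_ex w; rewrite (bigD1 i) //= iw big1 // => j ji.
apply/eqP; rewrite eqb0; apply: contra ji => jw; apply/eqP/val_inj.
by have := extends_uniq jw iw; rewrite !modn_small.
Qed.

(** Double counting of the pairs of a word [w] extending [h] and a window covering [w]: each [w]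
    lies in exactly one pair. *)
Lemma sum_compatible (h : nat -> option A) :
  \sum_(i < N) compatible n h (win i) *
     #|A| ^ (\sum_(k < n) ((h k == None) && (win i k == None)))
  = #|A| ^ (\sum_(k < n) (h k == None)).
Proof.
rewrite -(card_extends n) -[RHS]sum1_card.
under [RHS]eq_bigr => w _ do rewrite -(sum_extends w).
rewrite exchange_big /=; apply: eq_bigr => i _.
rewrite -card_extends2 -sum1_card big_mkcond [RHS]big_mkcond /=.
by apply: eq_bigr => w _; rewrite !inE; case: extends; case: extends.
Qed.

Lemma compatible_win i j : compatible n (win i) (win j) -> i = j %[mod N].
Proof.
by case/(compatible_extends letter_exists) => w /andP[]; apply: extends_uniq.
Qed.

(* Let [g i] be a diamond and [g (i + n)] a letter [a]. A word [z] of length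
   [n - 1] filling the common part of the windows at [i] and [i + 1] can only
   be preceded by the diamond at [i], hence only be followed by [a]; so [z b]
   is not covered when [b] differs from [a]. *)
Lemma diamond_periodic i : g i = None -> g (i + n) = None.
Proof.
move=> gi; case gin: (g (i + n)) => [a|//]; exfalso.
have n0 : 0 < n by case: upu.
have [b ba] : exists b, b != a.
  have: 0 < #|predC1 a| by rewrite cardC1; case: #|A| cardA => [|[]].
  by case/card_gt0P => b; rewrite inE; exists b.
pose w := [ffun k : 'I_n => if k.+1 == n then b else odflt b (g (i + k.+1))].
have [j jw] := extends_ex w.
(* This is [j - 1] modulo [N], without truncated subtraction. *)
pose j' := j + N.-1.
have N0 := size_upcycle_gt0.
have j'S k : g (j' + k.+1) = g (j + k).
  by rewrite -[RHS]gDN; congr g; rewrite /j'; lia.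
have ij' : i = j' %[mod N].
  apply: compatible_win; apply/forallP => -[[|k] kn] /=.
    by rewrite /win addn0 gi.
  have kn' : k < n by lia.
  move/forallP/(_ (Ordinal kn')): jw; rewrite /win ffunE /= j'S.
  have -> : (k.+1 == n) = false by lia.
  by case: (g (j + k)) (g (i + k.+1)) => [c|] [e|] //= /eqP[->]; rewrite ?eqxx ?orbT.
have kn : n.-1 < n by lia.
move/forallP/(_ (Ordinal kn)): jw; rewrite /win ffunE /= prednK // eqxx -j'S.
by rewrite prednK // -(g_eqmod _ ij') gin /= => /eqP[ab]; rewrite ab eqxx in ba.
Qed.

Lemma F_periodic k : F (k + n) = F k.
Proof.
have step i : ~~ F i -> ~~ F (i + n).
  by rewrite /F; case gi: (g i) => [//|] _; rewrite diamond_periodic.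
apply/idP/idP; first by apply: contraLR; apply: step.
apply: contraLR => Fk.
have N0 := size_upcycle_gt0.
(* The two positions differ by [n * N], a whole number of turns, so diamonds pushed forward from
   [k + n] in steps of [n] come back to [k]. *)
have -> : F k = F (k + n + n * N.-1).
  rewrite /F /g; congr (isSome (nth _ _ _)).
  by rewrite -addnA -mulnS prednK // addnC modnMDl.
elim: N.-1 => [|q IH]; first by rewrite muln0 addn0.
by rewrite mulnS [n + n * q]addnC addnA step.
Qed.

Lemma F_letter : exists k, F k.
Proof.
have [_ [a /(nthP None)[k kN gk]]] := ntu.
by exists k; rewrite /F /g modn_small // gk.
Qed.

Lemma F_diamond : exists k, ~~ F k.
Proof.
have [/(nthP None)[k kN gk] _] := ntu.
by exists k; rewrite /F /g modn_small // gk.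
Qed.

(** * Differences between letter residues *)

Section Frame.

Variable m : nat.
Hypothesis m_gt0 : 0 < m.
Hypothesis Fm : forall k, F (k + m) = F k.

Let p := mkseq F m.

Lemma F_nth k : F k = nth false p (k %% m).
Proof. by rewrite nth_mkseq ?ltn_pmod // modn_periodic. Qed.

(** Without a common letter position the windows at [0] and [r] would be compatible, hence the same
    window, which does share its letters with itself. *)
Lemma frames_meet r :
  has (fun t => nth false p t && nth false p ((r + t) %% m)) (iota 0 m).
Proof.
apply: contraT => /hasPn noF.
have no k : ~~ (F k && F (r + k)).
  rewrite (F_nth k) (F_nth (r + k)) -modnDmr; apply: noF.
  by rewrite mem_iota ltn_pmod.
have r0 : 0 = r %[mod N].
  apply: compatible_win; apply/forallP => k.
  move: (no k); rewrite /F /win add0n.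
  by case: (g k) => //= a; case: (g (r + k)).
have [k Fk] := F_letter.
by move: (no k); rewrite /F -(g_eqmod k r0) andbb -/(F k) Fk.
Qed.

Lemma pattern_nonconst : has negb p && has id p.
Proof.
apply/andP; split; apply/hasP.
- have [k Fk] := F_diamond; exists (F k) => //.
  by rewrite F_nth mem_nth // size_mkseq ltn_pmod.
- have [k Fk] := F_letter; exists (F k) => //.
  by rewrite F_nth mem_nth // size_mkseq ltn_pmod.
Qed.

End Frame.

Lemma count_diamonds4 : (forall k, F (k + 4) = F k) -> count negb (mkseq F 4) = 1.
Proof.
move=> F4; have := @pattern_nonconst 4 isT F4.
(* Two letters realise only one of the differences 1 and 2, and a single letter realises neither. *)
move: (@frames_meet 4 isT F4 1) (@frames_meet 4 isT F4 2); rewrite /mkseq /=.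
by case: (F 0) (F 1) (F 2) (F 3) => [] [] [] [].
Qed.

(** * Period five: excluding two diamonds per period *)

Section PeriodFive.

Hypothesis F5 : forall k, F (k + 5) = F k.
Variable s : nat.
Hypothesis n5s : n = 5 * s.

(** Choose [d] in {1, 2} different, up to sign, from the distance between the two diamonds. Then the
    diamonds and their translates by [-d] fill four distinct residues, and [r0] is the fifth. *)
Lemma unique_difference : count negb (mkseq F 5) = 2 ->
  exists d r0, [/\ (d == 1) || (d == 2), r0 < 5,
    forall k, F k && F (k + d) = (k %% 5 == r0) & forall k, F k || F (k + d)].
Proof.
move=> cnt.
suff [d [r0 [d12 r5 H]]] : exists d r0, [/\ (d == 1) || (d == 2), r0 < 5 &
  all (fun k => (nth false (mkseq F 5) k && nth false (mkseq F 5) ((k + d) %% 5)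
         == (k == r0)) &&
     (nth false (mkseq F 5) k || nth false (mkseq F 5) ((k + d) %% 5))) (iota 0 5)].
  exists d, r0; split=> // k; rewrite (@F_nth 5 isT F5 k) (@F_nth 5 isT F5 (k + d));
  have /(allP H) /andP[/eqP + +] : k %% 5 \in iota 0 5
    by rewrite ?mem_iota ?ltn_pmod.
  - by rewrite modnDml.
  - by rewrite modnDml.
move: cnt; rewrite /mkseq /=.
case: (F 0) (F 1) (F 2) (F 3) (F 4) => [] [] [] [] [] //= _;
  first [ by exists 1, 0 | by exists 1, 1 | by exists 1, 2 | by exists 1, 3 | by exists 1, 4
        | by exists 2, 0 | by exists 2, 1 | by exists 2, 2 | by exists 2, 3 | by exists 2, 4].
Qed.

Section TwoDiamonds.

Variables d r0 : nat.
Hypothesis cnt2 : count negb (mkseq F 5) = 2.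
Hypothesis d12 : (d == 1) || (d == 2).
Hypothesis r0_lt5 : r0 < 5.
Hypothesis both : forall k, F k && F (k + d) = (k %% 5 == r0).
Hypothesis either : forall k, F k || F (k + d).

(** This is the equality V(i) = V(p). *)
Let agree i p := all (fun j => g (i + 5 * j) == g (p + 5 * j)) (iota 0 s).

Lemma s_gt0 : 0 < s.
Proof. by case: upu; rewrite n5s muln_gt0. Qed.

Lemma gNone k : (g k == None) = ~~ F k.
Proof. by rewrite /F; case: (g k). Qed.

Lemma F_eqmod5 i j : i = j %[mod 5] -> F i = F j.
Proof. by move=> ij; rewrite -(modn_periodic F5 i) ij modn_periodic. Qed.

Lemma agree_letter i p : agree i p -> F i = F p.
Proof.
move=> /allP/(_ 0); rewrite mem_iota s_gt0 muln0 !addn0.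
by rewrite /F => /(_ isT)/eqP->.
Qed.

Lemma agreeC i p : agree i p = agree p i.
Proof. by apply: eq_all => k; rewrite eq_sym. Qed.

Lemma agreeP i p k : agree i p -> k < n -> 5 %| k -> g (i + k) = g (p + k).
Proof.
move=> /allP M kn /dvdnP[j kj]; move: kn; rewrite kj mulnC n5s ltn_pmul2l // => js.
by apply/eqP/M; rewrite mem_iota.
Qed.

Lemma agree_disjoint i j : i %% 5 = r0 -> j %% 5 = r0 -> ~~ agree i (j + d).
Proof.
move=> ir jr; apply/negP => M.
have ji k : F (j + d + k) = F (i + k + d) by apply: F_eqmod5; lia.
(* By [both], these windows share letters only at offsets divisible by 5, where [M] makes them
   equal. *)
have ijd : i = j + d %[mod N].
  apply: compatible_win; apply/forallP => k; rewrite !gNone /win.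
  case Fi: (F (i + k)) => //=; case Fj: (F (j + d + k)) => //=.
  have := both (i + k); rewrite -ji Fi Fj /= => /esym/eqP ikr.
  by apply/eqP/(agreeP M) => //; lia.
(* Equal windows have equal frames, so [i + d] and [i + d + d] both carry letters; this forces
   [i + d] into the class [r0] of [i]. *)
have := both i; rewrite ir eqxx => /andP[_ Fid].
have := ji d; rewrite [LHS]/F -(g_eqmod _ ijd) -/(F _) Fid => /esym Fidd.
by have := both (i + d); rewrite Fid Fidd; lia.
Qed.

Lemma sum_diamonds5 i : \sum_(t < 5) ~~ F (i + t) = 2.
Proof.
rewrite (@sum_periodic (fun k => ~~ F k : nat)); last by move=> k; rewrite F5.
by rewrite (sum_ord5 (fun k => ~~ F k : nat)) -[RHS]cnt2 /mkseq /= addn0 !addnA. 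
Qed.

Let D := \sum_(i < N) ~~ F i.
Let C p := \sum_(i < N) agree i p.

(** Averaging over all blocks of five consecutive positions avoids having to know that 5 divides
    [N]. *)
Lemma diamonds_density : 5 * D = 2 * N.
Proof.
have -> : 2 * N = \sum_(i < N) \sum_(t < 5) ~~ F (t + i).
  have -> : 2 * N = \sum_(i < N) 2 by rewrite sum_nat_const card_ord mulnC.
  apply: eq_bigr => i _; rewrite -[LHS](sum_diamonds5 i).
  by apply: eq_bigr => t _; rewrite addnC.
have -> : 5 * D = \sum_(t < 5) D by rewrite sum_nat_const card_ord.
rewrite [RHS]exchange_big /=.
apply: eq_bigr => t _; rewrite (@sum_periodic (fun k => ~~ F k : nat)) //.
by move=> k; rewrite /F gDN.
Qed.

Lemma count_all : #|A| ^ (5 * s) = N * #|A| ^ (2 * s).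
Proof.
have := sum_compatible (fun=> None).
rewrite (eq_bigr (fun=> #|A| ^ (2 * s))) => [|i _]; last first.
  have -> : compatible n (fun=> None) (win i) by apply/forallP.
  under eq_bigr => k _ do rewrite gNone.
  have per k : (~~ F (i + (k + 5)) : nat) = ~~ F (i + k) by rewrite addnA F5.
  by rewrite mul1n n5s (sum_periodic_mul s per) sum_diamonds5 mulnC.
by rewrite !sum_nat_const !card_ord muln1 -n5s => ->.
Qed.

(** Here [h] is V(p) in residue class 0 and free elsewhere. A window starting with a letter has both
    diamond classes free and must agree with V(p); one starting with a diamond is always compatible
    and keeps one free class. *)
Lemma count_one p : F p ->
  #|A| ^ (4 * s) = #|A| ^ (2 * s) * C p + #|A| ^ s * D.
Proof.
move=> Fp; pose h k := if 5 %| k then g (p + k) else None.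
have hN k : (h k == None) = ~~ (5 %| k).
  rewrite /h; case: ifP => // k5; rewrite gNone -(F_eqmod5 (i := p)) ?Fp //; lia.
have := sum_compatible h.
under [in RHS]eq_bigr => k _ do rewrite hN.
rewrite [in RHS]n5s (@sum_periodic_mul (fun k => ~~ (5 %| k) : nat)); last first.
  by move=> k; congr (nat_of_bool (~~ _)); lia.
rewrite (sum_ord5 (fun k => ~~ (5 %| k) : nat)) mulnC => <-.
rewrite !big_distrr -big_split /=; apply: eq_bigr => i _.
under eq_bigr => k _ do rewrite hN gNone.
rewrite [in _ ^ _]n5s (@sum_periodic_mul (fun k => ~~ (5 %| k) && ~~ F (i + k) : nat)); last first.
  by move=> k; rewrite addnA F5; congr (nat_of_bool (~~ _ && _)); lia.
have -> : compatible n h (win i) = ~~ F i || agree i p.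
  apply/forallP/orP => [H|[Fi k|M k]].
  - case Fi: (F i); [right|by left].
    apply/allP => j; rewrite mem_iota /= => js.
    have jn : 5 * j < n by lia.
    have := H (Ordinal jn); rewrite hN /h /win /= dvdn_mulr // !gNone.
    by rewrite -(F_eqmod5 (i := i)) ?Fi /= 1?eq_sym //; lia.
  - rewrite hN gNone /win; case k5: (5 %| k) => //=.
    by rewrite -(F_eqmod5 (i := i)) ?Fi //; lia.
  - rewrite hN /h /win; case: ifP => //= k5.
    by rewrite (agreeP M) // eqxx orbT.
have := sum_diamonds5 i.
rewrite (sum_ord5 (fun t => ~~ F (i + t) : nat)) (sum_ord5 (fun t => ~~ (5 %| t) && ~~ F (i + t) : nat)) /= !addn0.
case Fi: (F i) => /= two.
  by rewrite !add0n in two *; rewrite two muln0 addn0 mulnC [s * 2]mulnC.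
have -> : agree i p = false.
  by apply: contraFF Fi => /agree_letter ->.
have -> : 0 + ~~ F (i + 1) + ~~ F (i + 2) + ~~ F (i + 3) + ~~ F (i + 4) = 1.
  by apply/eqP; rewrite -(eqn_add2l 1) !addnA two.
by rewrite mul1n !muln1 muln0.
Qed.

(** By [either], each window meets class 0 or class [d] in letters. Those meeting both are excluded
    by [disj]; the others are tested against one word only and keep one free class. *)
Lemma count_two p q : F p -> F (q + d) ->
  (forall i, i %% 5 = r0 -> ~~ agree i p && ~~ agree (i + d) (q + d)) ->
  #|A| ^ (3 * s) = #|A| ^ s * (C p + C (q + d)).
Proof.
move=> Fp Fq disj.
pose h k := if 5 %| k then g (p + k)
            else if k == d %[mod 5] then g (q + k) else None.
have hN k : (h k == None) = ~~ ((5 %| k) || (k == d %[mod 5])).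
  rewrite /h; case: ifP => k5.
    by rewrite gNone -(F_eqmod5 (i := p)) ?Fp //; lia.
  case: ifP => // kd; rewrite gNone -(F_eqmod5 (i := q + d)) ?Fq //.
  by rewrite -modnDmr -(eqP kd) modnDmr.
have := sum_compatible h.
under [in RHS]eq_bigr => k _ do rewrite hN.
have per k : (~~ ((5 %| k + 5) || (k + 5 == d %[mod 5])) : nat) =
             ~~ ((5 %| k) || (k == d %[mod 5])).
  by rewrite modnDr /dvdn modnDr.
rewrite [in RHS]n5s (sum_periodic_mul s per).
rewrite (sum_ord5 (fun k => ~~ ((5 %| k) || (k == d %[mod 5])) : nat)).
have -> : ~~ ((5 %| 0) || (0 == d %[mod 5])) + ~~ ((5 %| 1) || (1 == d %[mod 5])) +
  ~~ ((5 %| 2) || (2 == d %[mod 5])) + ~~ ((5 %| 3) || (3 == d %[mod 5])) +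
  ~~ ((5 %| 4) || (4 == d %[mod 5])) = 3 by case/orP: d12 => /eqP->.
rewrite [s * 3]mulnC => <-.
(* The window at [i] shows V(i + d) in class [d], so the count is reindexed by a cyclic shift. *)
have -> : C (q + d) = \sum_(i < N) agree (i + d) (q + d).
  have perN k : (agree (k + N) (q + d) : nat) = agree k (q + d).
    by congr nat_of_bool; apply: eq_all => j; rewrite addnAC gDN.
  apply: etrans (esym (sum_periodic perN d)) _.
  by apply: eq_bigr => i _; rewrite addnC.
rewrite -big_split big_distrr /=; apply: eq_bigr => i _.
have compatP : compatible n h (win i) -> (F i -> agree i p) /\
    (F (i + d) -> agree (i + d) (q + d)).
  move=> /forallP H; split=> Fi; apply/allP => j; rewrite mem_iota /= => js.
  - have jn : 5 * j < n by lia.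
    have := H (Ordinal jn); rewrite hN /h /win /= dvdn_mulr // !gNone.
    by rewrite -(F_eqmod5 (i := i)) ?Fi /= 1?eq_sym //; lia.
  - have jn : d + 5 * j < n by case/orP: d12 => /eqP->; lia.
    have := H (Ordinal jn); rewrite hN /h /win /= !gNone.
    have -> : (5 %| d + 5 * j) = false by case/orP: d12 => /eqP->; lia.
    have -> : d + 5 * j == d %[mod 5] by lia.
    rewrite !addnA -(F_eqmod5 (i := i + d)) ?Fi /= 1?eq_sym //; lia.
have compat : (F i -> agree i p) -> (F (i + d) -> agree (i + d) (q + d)) ->
    compatible n h (win i).
  move=> Mp Mq; apply/forallP => k; rewrite hN gNone /win /h.
  case: ifP => /= k5.
    case Fik: (F (i + k)) => //=; rewrite (@agreeP i p) ?eqxx //.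
    by apply: Mp; rewrite (F_eqmod5 (j := i + k)) ?Fik //; lia.
  case: ifP => //= kd; case Fik: (F (i + k)) => //=.
  have Fid : F (i + d) by rewrite (F_eqmod5 (j := i + k)) ?Fik //; lia.
  have dk : d <= k by case/orP: d12 kd => /eqP->; lia.
  have := @agreeP _ _ (k - d) (Mq Fid); rewrite -!addnA subnKC // => ->//.
  - by have := ltn_ord k; lia.
  - by lia.
have := either i; have := both i.
case: (i %% 5 =P r0) => [ir|_].
  move=> /andP[Fi Fid] _; have /andP[/negbTE Mi /negbTE Mid] := disj _ ir.
  rewrite Mi Mid muln0; case: compatible compatP => //.
  by case=> // /(_ Fi); rewrite Mi.
move=> FF FFd.
have -> : compatible n h (win i) = agree i p + agree (i + d) (q + d) :> nat.
  move: FF FFd; case Fi: (F i) compatP compat => /= compatP compat Fid.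
    have -> : agree (i + d) (q + d) = false.
      by apply: contraFF Fid => /agree_letter ->.
    move=> _; rewrite addn0; congr nat_of_bool; apply/idP/idP => [/compatP[/(_ isT)]|M] //.
    by apply: compat => //; rewrite Fid.
  move=> {}Fid; have -> : agree i p = false.
    by apply: contraFF Fi => /agree_letter ->.
  congr nat_of_bool; apply/idP/idP => [/compatP[_ /(_ Fid)]|M] //.
  exact: compat.
rewrite mulnC; congr (#|A| ^ _ * _).
under eq_bigr => k _ do rewrite hN gNone.
have per2 k : (~~ ((5 %| k + 5) || (k + 5 == d %[mod 5])) && ~~ F (i + (k + 5)) : nat)
    = ~~ ((5 %| k) || (k == d %[mod 5])) && ~~ F (i + k).
  by rewrite modnDr /dvdn modnDr addnA F5.
rewrite n5s (sum_periodic_mul s per2).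
rewrite (sum_ord5 (fun k => ~~ ((5 %| k) || (k == d %[mod 5])) && ~~ F (i + k) : nat)).
have := sum_diamonds5 i; rewrite (sum_ord5 (fun t => ~~ F (i + t) : nat)) addn0.
move: FF FFd; case/orP: d12 => /eqP->;
  case: (F i) (F (i + 1)) (F (i + 2)) (F (i + 3)) (F (i + 4)) => [] [] [] [] [] //=;
  by rewrite ?muln1.
Qed.

Lemma two_diamonds_absurd : False.
Proof.
have r5 : r0 %% 5 = r0 by rewrite modn_small.
have := both r0; rewrite r5 eqxx => /andP[Fr Frd].
have dr : d <= r0 + 5 by case/orP: d12 => /eqP->; lia.
have q5 : r0 + 5 - d + d = r0 + 5 by rewrite subnK.
(* The words chosen are V(r0 + d) for class 0 and V(r0 + 5) for class [d], each from the side
   opposite to the one required at [r0]; adding 5 keeps the subtraction exact. *)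
have := @count_two (r0 + d) (r0 + 5 - d) Frd.
rewrite q5 F5 => /(_ Fr).
have disj i : i %% 5 = r0 ->
    ~~ agree i (r0 + d) && ~~ agree (i + d) (r0 + 5).
  by move=> ir; rewrite agree_disjoint // agreeC agree_disjoint // modnDr.
move=> /(_ disj).
have := count_one Frd; have := @count_one (r0 + 5); rewrite F5 => /(_ Fr).
have := count_all; have := diamonds_density.
have X0 : 0 < #|A| ^ s by rewrite expn_gt0 (ltnW cardA).
rewrite ![_ * s]mulnC !expnM.
have N0 := size_upcycle_gt0.
move: (C _) (C _) D N0 (#|A| ^ s) X0 => C1 C2 D' + X X0.
move: N => N' N0 ND XN X1 X2 X12.
(* The two one-class counts add up to 2 X^4 = X^2 (C1 + C2) + 2 X D', and the two-class count turns
   the first summand into X^4. *)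
have XD : X ^ 3 = 2 * D' by apply/eqP; rewrite -(eqn_pmul2l X0); apply/eqP; nia.
have : N' = X ^ 3 by apply/eqP; rewrite -(eqn_pmul2l X0) -(eqn_pmul2l X0); apply/eqP; nia.
lia.
Qed.

End TwoDiamonds.

Lemma count_diamonds5 : count negb (mkseq F 5) = 1.
Proof.
have : count negb (mkseq F 5) != 2.
  apply/eqP => cnt2; have [d [r0 [d12 r05 both either]]] := unique_difference cnt2.
  exact: (two_diamonds_absurd cnt2 d12 r05 both either).
have := @pattern_nonconst 5 isT F5.
(* Two letters modulo 5 differ by 1 or by 2 up to sign, never both, so at least three letters are
   needed. *)
move: (@frames_meet 5 isT F5 1) (@frames_meet 5 isT F5 2); rewrite /mkseq /=.
by case: (F 0) (F 1) (F 2) (F 3) (F 4) => [] [] [] [] [].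
Qed.

End PeriodFive.

(** * From one diamond per period to the diamondicity *)

Lemma diamondicity m : (m = 4 \/ m = 5) -> m %| n ->
  (forall k, F (k + m) = F k) -> has_diamondicity n u (n %/ m).
Proof.
move=> m45 /dvdnP[s ns] Fm i.
have m0 : 0 < m by case: m45 => ->.
have cnt1 : \sum_(k < m) ~~ F k = 1.
  transitivity (count negb (mkseq F m)).
    by rewrite count_map count_iota.
  case: m45 ns Fm => -> ns Fm; first exact: count_diamonds4.
  by apply: (count_diamonds5 Fm (s := s)); rewrite mulnC.
rewrite windowE count_map count_iota.
under eq_bigr => k _ do rewrite /= /win gNone.
have per k : (~~ F (i + (k + m)) : nat) = ~~ F (i + k) by rewrite addnA Fm.
rewrite ns mulnC (sum_periodic_mul s per) mulKn //.
by rewrite (@sum_periodic (fun k => ~~ F k : nat)) ?cnt1 ?muln1 // => k; rewrite Fm.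
Qed.

Lemma frame_period m : 0 < m -> has_frame_period n u m ->
  m %| n /\ forall k, F (k + m) = F k.
Proof.
move=> m0 perm.
have N0 := size_upcycle_gt0.
have root k : exists p s, [/\ size p = m, 0 < s & flatten (nseq s p) = frame (window n u k)].
  have [p [[[s [s0 sp]] _] pm]] := perm (Ordinal (ltn_pmod k N0)).
  exists p, s; split=> //; rewrite sp; congr (frame _); apply: eq_map => t.
  by rewrite /= modnDml.
have sizef k p s : size p = m -> flatten (nseq s p) = frame (window n u k) -> n = s * m.
  move=> pm /(congr1 size); rewrite size_flatten /shape map_nseq sumn_nseq pm.
  by rewrite /frame size_map windowE size_map size_iota mulnC => ->.
split=> [|k].
  by have [p [s [pm _ /(sizef _ _ _ pm) ->]]] := root 0; apply: dvdn_mull.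
have [p [s [pm s0 eqp]]] := root k.
(* If [s = 1], then [k + m] is outside the window and [F_periodic] applies with [n = m]; otherwise
   [k] and [k + m] start two consecutive copies of [p]. *)
have := sizef _ _ _ pm eqp; case: s s0 eqp => [|[|s]] // _ eqp nsm.
  by have := F_periodic k; rewrite nsm mul1n.
have Fn t : t < n -> F (k + t) = nth false (frame (window n u k)) t.
  move=> tn; rewrite /frame windowE -map_comp (nth_map 0) ?size_iota //.
  by rewrite nth_iota.
have := Fn 0; rewrite addn0 => ->; last by lia.
rewrite Fn; last by rewrite nsm !mulSn; lia.
by rewrite -eqp /= !nth_cat pm ltnn subnn m0.
Qed.

End Upcycle.

Theorem corollary8p14 (A : finType) (hA : 1 < #|A|) (m : nat)
    (hm : m = 4 \/ m = 5) :
  (forall (n : nat) (u : pword A),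
     upcycle n u -> nontrivial u -> has_frame_period n u m ->
     m %| n /\ has_diamondicity n u (n %/ m)) /\
  (forall u : pword A,
     upcycle m u -> nontrivial u -> has_diamondicity m u 1).
Proof.
have m0 : 0 < m by case: hm => ->.
split=> [n u upu ntu per | u upu ntu].
  have [mn Fm] := frame_period hA upu ntu m0 per.
  by split=> //; apply: diamondicity.
(* For words of length [m], the periodicity of diamonds already gives the frame the period [m]. *)
have := diamondicity hA upu ntu hm (dvdnn m) (F_periodic hA upu ntu).
by rewrite divnn m0.
Qed.
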